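(* Let $A\in\mathbb{R}^{r\times k}$ have full column rank $k$, and let $b\in\mathbb{R}^r$, $c\in\mathbb{R}^k$, $d\in\mathbb{R}$. Set $$X=\begin{bmatrix}A & b\\ c^{T} & d\end{bmatrix}\in\mathbb{R}^{(r+1)\times(k+1)},\qquad u=(I-AA^+)b,\qquad \gamma=d-c^{T}A^+b .$$ Then $$\det\bigl(X^{T}X\bigr)=\det\bigl(A^{T}A+cc^{T}\bigr)\,\lVert u\rVert^2+\det\bigl(A^{T}A\bigr)\,\gamma^2 .$$
   Context: $A^+$ denotes the Moore–Penrose pseudoinverse of $A$, $I$ is the $r\times r$ identity matrix, and $\lVert\cdot\rVert$ is the Euclidean norm. *)

(* Defs.v *)
From mathcomp Require Import all_boot all_order all_algebra.
From mathcomp Require Import reals.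

Set Implicit Arguments.
Unset Strict Implicit.
Unset Printing Implicit Defensive.

Import Order.TTheory GRing.Theory Num.Theory.
Local Open Scope ring_scope.

(* The four Penrose equations, over an ordered field: conjugate transposition
   is plain transposition. *)
Definition is_moore_penrose (R : realFieldType) (m n : nat)
    (A : 'M[R]_(m, n)) (B : 'M[R]_(n, m)) : bool :=
  [&& A *m B *m A == A, B *m A *m B == B,
      (A *m B)^T == A *m B & (B *m A)^T == B *m A].

Lemma gram_unit (R : realFieldType) (m n : nat) (A : 'M[R]_(m, n)) :
  row_free A -> A *m A^T \in unitmx.
Proof.
move=> freeA; rewrite -row_free_unit -kermx_eq0; apply/eqP/row_matrixP => i.
set v := row i _; rewrite row0.
have vAA : v *m (A *m A^T) = 0 by rewrite /v -row_mul mulmx_ker row0.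
have vA0 : v *m A = 0.
  have : (v *m A *m (v *m A)^T) 0 0 = 0.
    by rewrite trmx_mul mulmxA -(mulmxA v) vAA mul0mx mxE.
  rewrite mxE => sum0; apply/rowP => j; rewrite [RHS]mxE.
  have sq_ge0 (i0 : 'I_n) : true -> 0 <= (v *m A) 0 i0 * (v *m A)^T i0 0.
    by rewrite [_^T _ _]mxE -expr2 sqr_ge0.
  have := psumr_eq0P sq_ge0 sum0 (i:=j) isT.
  by rewrite [_^T _ _]mxE => /eqP; rewrite mulf_eq0 orbb => /eqP.
by apply: (row_free_inj freeA); rewrite vA0 mul0mx.
Qed.

Lemma moore_penrose_exists (R : realFieldType) (m n : nat)
    (A : 'M[R]_(m, n)) : exists B, is_moore_penrose A B.
Proof.
have [q [C [F [-> uC uF]]]] : exists q (C : 'M[R]_(m, q)) (F : 'M[R]_(q, n)),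
    [/\ A = C *m F, C^T *m C \in unitmx & F *m F^T \in unitmx].
  exists (\rank A), (col_base A), (row_base A); split.
  - by rewrite mulmx_base.
  - rewrite -[X in _ *m X]trmxK; apply: gram_unit.
    by rewrite /row_free mxrank_tr; have := col_base_full A.
  - exact/gram_unit/row_base_free.
set iF := invmx (F *m F^T); set iC := invmx (C^T *m C).
exists (F^T *m iF *m (iC *m C^T)).
have AB : C *m F *m (F^T *m iF *m (iC *m C^T)) = C *m iC *m C^T.
  by rewrite -!mulmxA (mulmxA F) (mulmxA (F *m _)) mulmxV // mul1mx.
have BA : F^T *m iF *m (iC *m C^T) *m (C *m F) = F^T *m iF *m F.
  by rewrite -!mulmxA (mulmxA C^T) (mulmxA iC) mulVmx // mul1mx.
apply/and4P; split; apply/eqP.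
- by rewrite AB -!mulmxA (mulmxA C^T) (mulmxA iC) mulVmx // mul1mx.
- by rewrite BA -!mulmxA (mulmxA F) (mulmxA iF) mulVmx // mul1mx.
- by rewrite AB !trmx_mul trmxK trmx_inv trmx_mul trmxK mulmxA.
- by rewrite BA !trmx_mul trmxK trmx_inv trmx_mul trmxK mulmxA.
Qed.

Definition moore_penrose (R : realFieldType) (m n : nat)
    (A : 'M[R]_(m, n)) : 'M[R]_(n, m) :=
  xchoose (moore_penrose_exists A).

Lemma moore_penroseP (R : realFieldType) (m n : nat) (A : 'M[R]_(m, n)) :
  is_moore_penrose A (moore_penrose A).
Proof. exact: xchooseP. Qed.

Lemma moore_penrose_uniq (R : realFieldType) (m n : nat)
    (A : 'M[R]_(m, n)) (B : 'M[R]_(n, m)) :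
  is_moore_penrose A B -> B = moore_penrose A.
Proof.
move: (moore_penrose A) (moore_penroseP A) => D.
case/and4P=> /eqP ADA /eqP DAD /eqP tAD /eqP tDA.
case/and4P=> /eqP ABA /eqP BAB /eqP tAB /eqP tBA.
have AE : A *m B = A *m D.
  by rewrite -tAB -{1}ADA -(mulmxA (A *m D)) trmx_mul tAB tAD mulmxA ABA.
have BE : B *m A = D *m A.
  by rewrite -tBA -{1}ADA -mulmxA mulmxA trmx_mul tDA tBA -mulmxA (mulmxA A) ABA.
by rewrite -BAB BE -mulmxA AE mulmxA DAD.
Qed.

(* The library norm `|u| on matrices is the max norm. *)
Definition euclid_norm (R : rcfType) (n : nat) (u : 'cV[R]_n) : R :=
  Num.sqrt (\sum_(i < n) u i 0 ^+ 2).

(* Main.v *)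
Require Import Defs.
From mathcomp Require Import all_boot all_order all_algebra.
From mathcomp Require Import reals.

(** Subtracting from the last column of [X] the combination of the first [k]
    columns with coefficients [A^+ b] is a unimodular column operation; it turns
    that column into [(u, gamma)] and leaves the Gram determinant unchanged.
    As [A A^+] is the orthogonal projector onto the range of [A], the vector [u]
    is orthogonal to the columns of [A], so the Gram matrix becomes
<<
      [ A^T A + c c^T      gamma c            ]
      [ gamma c^T          |u|^2 + gamma^2    ]
>>
    Splitting the corner entry by linearity in the last row
    ([det_block_mx_addr]) gives the term [det (A^T A + c c^T) |u|^2], plus the
    determinant of the same matrix with corner [gamma^2]. The latter matrix
    factors through [diag (A^T A, 1)] with triangular factors of determinant
    [gamma] ([det_bordered_gram]), which gives the second term. *)

Import Order.TTheory GRing.Theory Num.Theory.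
Local Open Scope ring_scope.

(** The determinant is additive in its last row, and the row [(0, s)] leaves a
    block triangular matrix. *)
Lemma det_block_mx_addr (R : comNzRingType) (n : nat) (M : 'M[R]_n)
    (x : 'cV[R]_n) (y : 'rV[R]_n) (s t : 'M[R]_1) :
  \det (block_mx M x y (s + t)) = \det M * \det s + \det (block_mx M x y t).
Proof.
rewrite -(det_ublock M x s) -[X in _ = X + _]mul1r -[X in _ = _ + X]mul1r.
apply: (@determinant_multilinear _ _ _ _ _ (rshift n ord0)).
- rewrite !scale1r /block_mx !rowKd -linearD.
  by rewrite add_row_mx add0r.
(* Removing the last row leaves an empty bottom block. *)
- rewrite /block_mx !row'Kd; congr (castmx _ (col_mx _ _)).
  by apply/matrixP => -[].
- rewrite /block_mx !row'Kd; congr (castmx _ (col_mx _ _)).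
  by apply/matrixP => -[].
Qed.

(** The bordered matrix is [P diag(G, 1) P^T], where [P] is block upper
    triangular with diagonal blocks [1] and [g]. *)
Lemma det_bordered_gram (R : comNzRingType) (n : nat) (G : 'M[R]_n)
    (c : 'cV[R]_n) (g : R) :
  \det (block_mx (G + c *m c^T) (g *: c) (g *: c^T) (g ^+ 2)%:M)
    = \det G * g ^+ 2.
Proof.
pose P := block_mx 1%:M c 0 (g%:M : 'M_1).
pose D := block_mx G 0 0 (1%:M : 'M_1).
have -> : block_mx (G + c *m c^T) (g *: c) (g *: c^T) (g ^+ 2)%:M
          = P *m D *m P^T.
  rewrite /P /D tr_block_mx !mulmx_block !trmx1 !tr_scalar_mx trmx0.
  rewrite !mul1mx !mulmx1 !mulmx0 !mul0mx !addr0 !add0r.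
  by rewrite mul_mx_scalar mul_scalar_mx -scalar_mxM.
by rewrite !det_mulmx det_tr !det_ublock !det1 det_scalar1 !mul1r mulr1 (mulrC g) -mulrA.
Qed.

(** [A A^+] is symmetric and fixes [A], hence [A^T (A A^+) = (A A^+ A)^T]. *)
Lemma trmx_mul_moore_penrose (R : realFieldType) (m n : nat)
    (A : 'M[R]_(m, n)) : A^T *m (A *m moore_penrose A) = A^T.
Proof.
case/and4P: (moore_penroseP A) => /eqP AMA _ /eqP sym _.
by rewrite -sym -trmx_mul AMA.
Qed.

Lemma trmx_mul_euclid_norm (R : rcfType) (n : nat) (u : 'cV[R]_n) :
  u^T *m u = (euclid_norm u ^+ 2)%:M.
Proof.
rewrite [LHS]mx11_scalar /euclid_norm sqr_sqrtr; last first.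
  by apply: sumr_ge0 => i _; exact: sqr_ge0.
by rewrite mxE; congr _%:M; apply: eq_bigr => i _; rewrite mxE expr2.
Qed.

Theorem proposition3 (R : realType) (r k : nat) (A : 'M[R]_(r, k))
    (b : 'cV[R]_r) (c : 'cV[R]_k) (d : R) (rankA : \rank A = k) :
  let X : 'M[R]_(r + 1, k + 1) := block_mx A b c^T d%:M in
  let u : 'cV[R]_r := (1%:M - A *m moore_penrose A) *m b in
  let gamma : R := d - (c^T *m moore_penrose A *m b) 0 0 in
  \det (X^T *m X) =
    \det (A^T *m A + c *m c^T) * euclid_norm u ^+ 2
    + \det (A^T *m A) * gamma ^+ 2.
Proof.
move=> X u gamma.
pose w := moore_penrose A *m b.
pose E := block_mx 1%:M (- w) 0 (1%:M : 'M_1).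
have detE : \det E = 1 by rewrite det_ublock !det1 mulr1.
have XE : X *m E = block_mx A u c^T gamma%:M.
  rewrite mulmx_block !mulmx1 !mulmx0 !addr0 !mulmxN; congr block_mx.
    by rewrite /u mulmxBl mul1mx -mulmxA addrC.
  by rewrite addrC /gamma raddfB /= -mulmxA -mx11_scalar.
have Au0 : A^T *m u = 0.
  by rewrite mulmxA mulmxBr mulmx1 trmx_mul_moore_penrose subrr mul0mx.
have uA0 : u^T *m A = 0 by rewrite -[LHS]trmxK trmx_mul trmxK Au0 trmx0.
have -> : \det (X^T *m X) = \det ((X *m E)^T *m (X *m E)).
  by rewrite trmx_mul mulmxA -(mulmxA E^T) !det_mulmx det_tr detE mul1r mulr1.
rewrite XE tr_block_mx mulmx_block trmxK tr_scalar_mx Au0 uA0 !add0r.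
rewrite mul_mx_scalar mul_scalar_mx -scalar_mxM -expr2 trmx_mul_euclid_norm.
by rewrite det_block_mx_addr det_scalar1 det_bordered_gram.
Qed.
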